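(* Let $\mathcal{H}$ be a separable complex Hilbert space and let $T \in \mathcal{B}(\mathcal{H})$ be a product of two projections. Then $$T|_{\mathcal{H}_{cnu}} \in C_{00},$$ where $\mathcal{H}_{cnu}$ is the completely non-unitary part of the contraction $T$.
   Context: A projection is an orthogonal projection: $P \in \mathcal{B}(\mathcal{H})$ with $P = P^* = P^2$. For a contraction $T \in \mathcal{B}(\mathcal{H})$, the canonical (Nagy-Foias and Langer) decomposition is the unique orthogonal decomposition $\mathcal{H} = \mathcal{H}_u \oplus \mathcal{H}_{cnu}$ such that both summands reduce $T$, $T|_{\mathcal{H}_u}$ is unitary, and $T|_{\mathcal{H}_{cnu}}$ is completely non-unitary (it has no nontrivial unitary summand). Here $\mathcal{H}_u = \{h \in \mathcal{H}: \|T^m h\| = \|T^{*m} h\| = \|h\| \text{ for all } m \in \mathbb{N}\}$ and $\mathcal{H}_{cnu} = \mathcal{H}_u^\perp$. A contraction $S$ is in $C_{\cdot 0}$ if $S^{*m} \to 0$ in the strong operator topology as $m \to \infty$; $S \in C_{00}$ means that both $S$ and $S^*$ are in $C_{\cdot 0}$. *)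

(* Defs.v *)
From HB Require Import structures.
From mathcomp Require Import all_boot all_order all_algebra complex.
From mathcomp Require Import boolp classical_sets cardinality reals.
From mathcomp Require Import topology normedtype sequences.
From mathcomp Require Import ring lra.
Set Implicit Arguments.
Unset Strict Implicit.
Unset Printing Implicit Defensive.
Import Order.TTheory GRing.Theory Num.Theory.
Import numFieldNormedType.Exports.
Local Open Scope classical_set_scope.
Local Open Scope ring_scope.

(* [inner] is linear in its first argument and conjugate-linear in the second;
   [innerE] ties it to the norm with respect to which H is complete. *)
HB.mixin Record CompleteNormedModule_isHilbert (R : realType) (H : Type)
    of CompleteNormedModule R[i] H := {
  inner : {dot H for (@Num.conj R[i])};
  innerE : forall x : H, inner x x = `|x| ^+ 2
}.

#[short(type="hilbertType")]
HB.structure Definition Hilbert (R : realType) :=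
  {H of CompleteNormedModule R[i] H & CompleteNormedModule_isHilbert R H}.

Notation "''[' x , y ]" := (inner x y) : ring_scope.

Definition separable (T : topologicalType) : Prop :=
  exists2 D : set T, countable D & dense D.

Record bop (R : realType) (H : hilbertType R) := Bop {
  bop_fun :> {linear H -> H};
  bop_continuous : continuous bop_fun
}.
Notation "''B' ( H )" := (bop H) (format "''B' ( H )") : type_scope.

Section inner_theory.
Context {R : realType} {H : hilbertType R}.
Implicit Types (x y z v : H) (T : 'B(H)).

Lemma innerC x y : '[x, y] = Num.conj '[y, x].
Proof. by have := hermC (@inner R H) x y; rewrite expr0 mul1r. Qed.

Lemma innerDl x y z : '[x + y, z] = '[x, z] + '[y, z].
Proof. exact: linearDl. Qed.

Lemma innerDr x y z : '[x, y + z] = '[x, y] + '[x, z].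
Proof. exact: linearDr. Qed.

Lemma innerZl a x y : '[a *: x, y] = a * '[x, y].
Proof. exact: linearZl_LR. Qed.

Lemma innerZr a x y : '[x, a *: y] = Num.conj a * '[x, y].
Proof. by rewrite innerC innerZl rmorphM (innerC x y). Qed.

Lemma inner0l x : '[0, x] = 0.
Proof. by rewrite -(scale0r x) innerZl mul0r. Qed.

Lemma innerBl x y z : '[x - y, z] = '[x, z] - '[y, z].
Proof. by rewrite -scaleN1r innerDl innerZl mulN1r. Qed.

Lemma inner_inj x y : (forall v, '[v, x] = '[v, y]) -> x = y.
Proof.
move=> xy; apply/eqP; rewrite -subr_eq0 -normr_eq0 -sqrf_eq0 -innerE.
by rewrite innerC innerBl (innerC x) (innerC y) xy subrr rmorph0.
Qed.

Definition rinner x y : R := complex.Re '[x, y].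

Lemma rinnerC x y : rinner x y = rinner y x.
Proof. by rewrite /rinner innerC; case: '[y, x]. Qed.

Lemma rinnerDl x y z : rinner (x + y) z = rinner x z + rinner y z.
Proof. by rewrite /rinner innerDl; case: '[x, z] => a b; case: '[y, z]. Qed.

Lemma rinnerDr x y z : rinner x (y + z) = rinner x y + rinner x z.
Proof. by rewrite rinnerC rinnerDl !(rinnerC x). Qed.

Lemma rinnerZl (t : R) x y : rinner (t%:C%C *: x) y = t * rinner x y.
Proof.
by rewrite /rinner innerZl; case: '[x, y] => a b /=; rewrite mul0r subr0.
Qed.

Lemma rinnerZr (t : R) x y : rinner x (t%:C%C *: y) = t * rinner x y.
Proof. by rewrite rinnerC rinnerZl rinnerC. Qed.

Lemma rinnerNl x y : rinner (- x) y = - rinner x y.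
Proof. by rewrite /rinner -(sub0r x) innerBl inner0l sub0r; case: '[x, y]. Qed.

Lemma rinnerNr x y : rinner x (- y) = - rinner x y.
Proof. by rewrite rinnerC rinnerNl rinnerC. Qed.

Lemma rinnerE x : (rinner x x)%:C%C = `|x| ^+ 2.
Proof.
rewrite -innerE /rinner RRe_real// innerE.
by rewrite realX// normr_real.
Qed.

Lemma rinner_ge0 x : 0 <= rinner x x.
Proof. by rewrite -lecR rinnerE exprn_ge0. Qed.

Lemma norm_lecP x (r : R) : 0 <= r ->
  (`|x| <= r%:C%C) = (rinner x x <= r ^+ 2).
Proof.
move=> r0; rewrite -lecR rinnerE rmorphXn/= ler_pXn2r// nnegrE//.
by rewrite lecR.
Qed.

Lemma norm_ltcP x (r : R) : 0 <= r ->
  (`|x| < r%:C%C) = (rinner x x < r ^+ 2).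
Proof.
move=> r0; rewrite -ltcR rinnerE rmorphXn/= ltr_pXn2r// nnegrE//.
by rewrite lecR.
Qed.

Let quad_disc (a b c : R) : 0 <= a ->
  (forall t, 0 <= a * t ^+ 2 + 2 * b * t + c) -> b ^+ 2 <= a * c.
Proof.
move=> a0 h; have [a00|an0] := eqVneq a 0.
  subst a; have [->|bn0] := eqVneq b 0; first by lra.
  have := h (- (c + 1) / (2 * b)).
  have -> : 0 * (- (c + 1) / (2 * b)) ^+ 2 + 2 * b * (- (c + 1) / (2 * b)) + c
            = - 1 :> R by field.
  by rewrite oppr_ge0 ler10.
have {}a0 : 0 < a by rewrite lt_def an0.
have := h (- b / a).
have -> : a * (- b / a) ^+ 2 + 2 * b * (- b / a) + c = (a * c - b ^+ 2) / a.
  by field.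
by rewrite pmulr_lge0 ?invr_gt0// subr_ge0.
Qed.

Lemma rinner_CS x y : rinner x y ^+ 2 <= rinner x x * rinner y y.
Proof.
rewrite mulrC; apply: quad_disc => [|t]; first exact: rinner_ge0.
have := rinner_ge0 (x + t%:C%C *: y).
rewrite !(rinnerDl, rinnerDr, rinnerZl, rinnerZr) (rinnerC y x).
by move=> /le_trans; apply; rewrite le_eqVlt; apply/orP; left; apply/eqP; ring.
Qed.

Lemma inner_CS x y : `|'[x, y]| <= `|x| * `|y|.
Proof.
have [->|a0] := eqVneq '[x, y] 0; first by rewrite normr0 mulr_ge0.
rewrite -(@ler_pXn2r _ 2)// ?nnegrE ?mulr_ge0// exprMn -!rinnerE.
set a := '[x, y] in a0 *.
have aE : rinner (Num.conj a *: x) y = complex.Re (`|a| ^+ 2).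
  by rewrite /rinner innerZl normCK mulrC.
have aR : `|a| ^+ 2 = (complex.Re (`|a| ^+ 2))%:C%C.
  by rewrite RRe_real// realX// normr_real.
have bE : rinner (Num.conj a *: x) (Num.conj a *: x) =
          complex.Re (`|a| ^+ 2) * rinner x x.
  apply: (@complexI R); rewrite rinnerE normrZ norm_conjC exprMn -rinnerE.
  by rewrite rmorphM/= -aR.
have := rinner_CS (Num.conj a *: x) y; rewrite aE bE aR -rmorphM lecR.
rewrite /= -mulrA expr2 ler_pM2l//.
by rewrite -ltcR -aR exprn_gt0// normr_gt0.
Qed.

(* Riesz representation for real-linear forms, obtained by minimizing
   x |-> |x|^2 - 2 g(x). *)
Lemma riesz (g : H -> R) (K : R) : 0 <= K ->
  {morph g : x y / x + y} -> (forall t x, g (t%:C%C *: x) = t * g x) ->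
  (forall x, g x ^+ 2 <= K * rinner x x) -> exists z, forall x, g x = rinner x z.
Proof.
move=> K0 gD gZ gK; pose J x := rinner x x - 2 * g x.
have JE x v t : J (x + t%:C%C *: v) =
    J x + (rinner v v * t ^+ 2 + 2 * (rinner x v - g v) * t).
  rewrite /J gD gZ !(rinnerDl, rinnerDr, rinnerZl, rinnerZr) (rinnerC v x).
  by ring.
have JK x : - K <= J x.
  have := gK x; have := rinner_ge0 x; rewrite /J.
  set a := rinner x x; set b := g x => a0 bK.
  rewrite leNgt; apply/negP => h.
  have h1 : 0 < 2 * b - (a + K) by lra.
  have h2 : 0 <= a + K by rewrite addr_ge0.
  have h3 : 0 < (2 * b - (a + K)) * (2 * b + (a + K)).
    by rewrite mulr_gt0//; lra.
  have h4 : 0 <= (a - K) ^+ 2 by exact: sqr_ge0.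
  have : (a - K) ^+ 2 = (a + K) ^+ 2 - 4 * (K * a) by ring.
  have : (2 * b - (a + K)) * (2 * b + (a + K)) = 4 * b ^+ 2 - (a + K) ^+ 2.
    by ring.
  by lra.
have Jinf : has_inf (range J).
  split; first by exists (J 0); exists 0.
  by exists (- K) => _ [x _ <-]; exact: JK.
pose m := inf (range J).
have mJ x : m <= J x by apply: ge_inf; [case: Jinf|exists x].
pose A d : set H := [set x | J x < m + d].
have A0 d : 0 < d -> A d !=set0.
  move=> /(inf_adherent)/(_ Jinf)[_ [x _ <-] xd].
  by exists x.
have AB d x y : A d x -> A d y -> rinner (x - y) (x - y) <= 4 * d.
  rewrite /A/= => xd yd; have := mJ (x + (2^-1)%:C%C *: (y - x)).
  have := JE x (y - x) (2^-1); have := JE x (y - x) 1.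
  rewrite scale1r (addrC x (y - x)) subrK => yE ->.
  have -> : rinner (x - y) (x - y) = rinner (y - x) (y - x).
    by rewrite -(opprB y x) rinnerNl rinnerNr opprK.
  move: xd yd yE; set n := rinner _ _; set p := rinner _ _ - _.
  by nra.
pose F := filter_from [set d : R | 0 < d] A.
have FF : ProperFilter F.
  apply: filter_from_proper => [|d]; last exact: A0.
  apply: filter_from_filter => [|d e d0 e0]; first by exists 1 => /=.
  exists (Order.min d e) => /=; first by rewrite lt_min d0.
  by move=> x xm; split; apply: (lt_le_trans xm);
    rewrite lerD2l ge_min lexx ?orbT.
have Fcauchy : cauchy F.
  apply/cauchy_ballP => e e0.
  have eR : e = (complex.Re e)%:C%C by rewrite RRe_real// realE ltW.
  have r0 : 0 < complex.Re e by rewrite -ltcR -eR.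
  set r := complex.Re e in eR r0.
  have d0 : 0 < r ^+ 2 / 8 by rewrite divr_gt0// exprn_gt0.
  exists (A (r ^+ 2 / 8), A (r ^+ 2 / 8)); first by split; exists (r ^+ 2 / 8).
  move=> [x y] /= [xA yA]; rewrite -ball_normE /ball_/= eR norm_ltcP ?ltW//.
  apply: (le_lt_trans (AB _ _ _ xA yA)); nra.
have /cvg_ex[z Fz] : cvg F by exact: cauchy_cvg.
have zA d : 0 < d -> exists2 x, A d x & rinner (z - x) (z - x) < d.
  move=> d0; have r0 : 0 < Num.sqrt d by rewrite sqrtr_gt0.
  have Fb : F (ball z (Num.sqrt d)%:C%C).
    by apply: Fz; apply: nbhsx_ballx; rewrite ltcR.
  have FA : F (A d) by exists d.
  have [x [xb xA]] := filter_ex (filterI Fb FA).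
  exists x => //; move: xb; rewrite -ball_normE /ball_/= norm_ltcP ?ltW//.
  by rewrite sqr_sqrtr// ltW.
have first_order d x v : A d x -> (rinner x v - g v) ^+ 2 <= rinner v v * d.
  move=> xA; apply: quad_disc => [|t]; first exact: rinner_ge0.
  have := mJ (x + t%:C%C *: v); rewrite JE; move: xA; rewrite /A/=; lra.
exists z => v; apply/eqP; rewrite eq_sym -subr_eq0 -sqrf_eq0 eq_le sqr_ge0 andbT.
rewrite leNgt; apply/negP => p0; set p := (_ ^+ 2) in p0.
have q0 : 0 < 4 * rinner v v + 1 by have := rinner_ge0 v; lra.
have [x xA xz] := zA _ (divr_gt0 p0 q0).
have h1 := first_order _ _ v xA; have h2 := rinner_CS (z - x) v.
have h3 : rinner z v = rinner (z - x) v + rinner x v by rewrite -rinnerDl subrK.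
move: h1 h2 xz; rewrite -/p; set d := p / _ => h1 h2 xz.
have dE : d * (4 * rinner v v + 1) = p by rewrite /d divfK// gt_eqF.
have d0 : 0 < d by rewrite divr_gt0.
have v0 := rinner_ge0 v.
have h4 : p <= 2 * rinner (z - x) v ^+ 2 + 2 * (rinner x v - g v) ^+ 2.
  rewrite /p (rinnerC v) h3; set u := rinner (z - x) v.
  have := sqr_ge0 (u - (rinner x v - g v)).
  by set w := rinner x v - g v; rewrite (_ : _ + _ - _ = u + w) /w; [nra|ring].
have h5 : rinner (z - x) (z - x) * rinner v v <= d * rinner v v.
  by rewrite ler_wpM2r// ltW.
by nra.
Qed.

Lemma bop_bounded T : exists2 K : R, 0 <= K &
  forall x, rinner (T x) (T x) <= K * rinner x x.
Proof.
have /linear_bounded_continuous/linear_boundedP := @bop_continuous R H T.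
move=> /pinfty_ex_gt0[c c0 Tc].
have cR : c = (complex.Re c)%:C%C by rewrite RRe_real// realE ltW.
exists (complex.Re c ^+ 2) => [|x]; first exact: sqr_ge0.
rewrite -lecR rmorphM rmorphXn/= !rinnerE -cR -exprMn.
by rewrite ler_pXn2r// nnegrE// mulr_ge0// ltW.
Qed.

Lemma adjoint_pointwise T y : exists z, forall x, '[T x, y] = '[x, z].
Proof.
have [K K0 TK] := bop_bounded T.
have [z zE] : exists z, forall x, rinner (T x) y = rinner x z.
  apply: (@riesz (fun x => rinner (T x) y) (K * rinner y y)).
  - by rewrite mulr_ge0// rinner_ge0.
  - by move=> u v; rewrite linearD rinnerDl.
  - by move=> t u; rewrite linearZ rinnerZl.
  - move=> x; apply: (le_trans (rinner_CS _ _)).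
    by rewrite mulrAC ler_wpM2r ?rinner_ge0.
exists z => x; have := zE x; have := zE ('i%C *: x).
rewrite /rinner linearZ/= !innerZl.
case: '[T x, y] => a b; case: '[x, z] => c d /=.
by rewrite !mul0r !mul1r !sub0r => /oppr_inj -> ->.
Qed.

Lemma adjoint_subproof T : exists S : 'B(H), forall x y, '[T x, y] = '[x, S y].
Proof.
have [f fE] := choice (adjoint_pointwise T).
have fL : linear f.
  move=> a u v; apply: inner_inj => x.
  by rewrite innerDr innerZr -!fE innerDr innerZr.
pose S : {linear H -> H} := HB.pack f (GRing.isLinear.Build _ _ _ _ f fL).
suff Sc : continuous S by exists (Bop Sc) => x y; exact: fE.
have [K K0 TK] := bop_bounded T.
apply/linear_bounded_continuous/linear_boundedP; near=> c => x.
have SK : rinner (S x) (S x) <= K * rinner x x.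
  have [S0|S0] := eqVneq (rinner (S x) (S x)) 0.
    by rewrite S0 mulr_ge0// rinner_ge0.
  have {}S0 : 0 < rinner (S x) (S x) by rewrite lt_def S0 rinner_ge0.
  have e : rinner (S x) (S x) = rinner (T (S x)) x.
    by rewrite /rinner fE.
  have := rinner_CS (T (S x)) x; rewrite -e expr2.
  have := TK (S x); set s := rinner (S x) _ in S0 *.
  move=> h1 h2; rewrite -(ler_pM2l S0); apply: (le_trans h2).
  by rewrite mulrCA mulrA ler_wpM2r ?rinner_ge0.
have : `|S x| <= (Num.sqrt K)%:C%C * `|x|.
  rewrite -(@ler_pXn2r _ 2)// ?nnegrE ?mulr_ge0// ?lecR ?sqrtr_ge0//.
  by rewrite exprMn -rmorphXn/= sqr_sqrtr// -!rinnerE -rmorphM lecR.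
move=> /le_trans; apply; rewrite ler_wpM2r//; near: c.
by apply: nbhs_pinfty_ge; rewrite realE lecR sqrtr_ge0.
Unshelve. all: by end_near. Qed.

(* Existence is the Riesz representation theorem; uniqueness is [inner_inj]. *)
Definition adj T : 'B(H) := projT1 (cid (adjoint_subproof T)).

Lemma adjE T x y : '[T x, y] = '[x, adj T y].
Proof. exact: (projT2 (cid (adjoint_subproof T))). Qed.

Lemma adjE' T x y : '[adj T x, y] = '[x, T y].
Proof. by rewrite innerC -adjE -innerC. Qed.
End inner_theory.

Record closed_submod (R : realType) (H : hilbertType R) := ClosedSubmod {
  csm_set :> set H;
  csm_submod : submod_closed [pred x | x \in csm_set];
  csm_closed : closed csm_set
}.

Definition csm_pred (R : realType) (H : hilbertType R) (M : closed_submod H) :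
  {pred H} := [pred x | x \in csm_set M].

HB.instance Definition _ (R : realType) (H : hilbertType R)
    (M : closed_submod H) :=
  GRing.isSubmodClosed.Build R[i] H (csm_pred M) (csm_submod M).

(* The instances below make a closed linear subspace a Hilbert space in its own
   right, for the norm and inner product of the ambient space. *)
Definition csm_type (R : realType) (H : hilbertType R) (M : closed_submod H) :=
  {x : H | x \in csm_pred M}.

Section closed_submod_hilbert.
Context {R : realType} {H : hilbertType R} (M : closed_submod H).
Local Notation subH := (csm_type M).

HB.instance Definition _ := SubChoice.on subH.
HB.instance Definition _ := [SubChoice_isSubLmodule of subH by <:].

Let norm (x : subH) : R[i] := `|\val x|.

Let norm_triangle x y : norm (x + y) <= norm x + norm y.
Proof. by rewrite /norm raddfD ler_normD. Qed.

Let normZ (a : R[i]) x : norm (a *: x) = `|a| * norm x.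
Proof. by rewrite /norm linearZ normrZ. Qed.

Let norm_eq0 x : norm x = 0 -> x = 0.
Proof.
by move=> /eqP; rewrite normr_eq0 => /eqP x0; apply: val_inj; rewrite x0 raddf0.
Qed.

HB.instance Definition _ :=
  Lmodule_isNormed.Build R[i] subH norm_triangle normZ norm_eq0.

Lemma csm_normE (x : subH) : `|x| = `|\val x|. Proof. by []. Qed.

Lemma csm_val_continuous : continuous (\val : subH -> H).
Proof.
move=> x; apply/(@cvgrPdist_lt _ _ _ (nbhs x)) => e e0.
have := @nbhsx_ballx _ subH x e e0; apply: filterS => y.
by rewrite -ball_normE /ball_/= csm_normE raddfB.
Qed.

Let csm_complete (F : set_system subH) : ProperFilter F -> cauchy F -> cvg F.
Proof.
move=> FF /cauchy_ballP Fc.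
have /cauchy_cvg/cvg_ex[z Fz] : cauchy ((\val : subH -> H) @ F).
  apply/cauchy_ballP => e e0; have [[A B] /= [FA FB] AB] := Fc e e0.
  exists (\val @` A, \val @` B) => /=.
    by split; [apply: filterS FA|apply: filterS FB] => x Ax; exists x.
  move=> [_ _] /= [[x Ax <-] [y By <-]].
  have := AB (x, y) (conj Ax By).
  by rewrite -!ball_normE /ball_/= csm_normE raddfB.
have zM : z \in csm_pred M.
  rewrite inE; apply: (closed_cvg _ (@csm_closed _ _ M) _ _ Fz).
  by apply: nearW => x; have := valP x; rewrite inE.
apply/cvg_ex; exists (Sub z zM); apply/cvgrPdist_lt => e e0.
have /cvgrPdist_lt/(_ e e0) := Fz.
by apply: filterS => x; rewrite csm_normE raddfB.
Qed.

HB.instance Definition _ := Uniform_isComplete.Build subH csm_complete.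

Let dot (x y : subH) : R[i] := '[\val x, \val y].

Let val_lin a (u v : subH) : \val (a *: u + v) = a *: \val u + \val v.
Proof. exact: linearP. Qed.

Let dot_linearl y : linear_for *%R (dot ^~ y).
Proof. by move=> a u v; rewrite /dot val_lin innerDl innerZl. Qed.

Let dot_linearr x : linear_for (Num.conj \; *%R) (dot x).
Proof. by move=> a u v; rewrite /dot val_lin innerDr innerZr. Qed.

HB.instance Definition _ := bilinear_isBilinear.Build R[i] subH subH R[i]
  *%R (Num.conj \; *%R) dot (conj dot_linearl dot_linearr).

Let dot_herm x y : dot x y = (-1) ^+ false * Num.conj (dot y x).
Proof. by rewrite expr0 mul1r /dot innerC. Qed.

HB.instance Definition _ :=
  isHermitianSesquilinear.Build R[i] subH false Num.conj dot dot_herm.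

Let dot_gt0 x : x != 0 -> 0 < dot x x.
Proof.
by move=> x0; rewrite /dot innerE -csm_normE exprn_gt0// normr_gt0.
Qed.

HB.instance Definition _ := isDotProduct.Build R[i] subH dot dot_gt0.

Let dotE x : dot x x = `|x| ^+ 2. Proof. exact: innerE. Qed.

HB.instance Definition _ :=
  CompleteNormedModule_isHilbert.Build R subH
    (dotE : forall x, (dot : {dot subH for Num.conj}) x x = _).

Lemma csm_innerE (x y : subH) : '[x, y] = '[\val x, \val y]. Proof. by []. Qed.
End closed_submod_hilbert.

Section operators.
Context {R : realType} {H : hilbertType R}.
Implicit Types (T P Q : 'B(H)) (A : set H) (M : closed_submod H).

Definition contraction T : Prop := forall h, `|T h| <= `|h|.

Definition projection P : Prop :=
  (P : H -> H) = adj P /\ (P : H -> H) = P \o P.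

Definition product_of_two_projections T : Prop :=
  exists P Q, [/\ projection P, projection Q & (T : H -> H) = P \o Q].

Definition C_dot0 T : Prop :=
  contraction T /\ forall h : H, iter m (adj T) h @[m --> \oo] --> (0 : H).

Definition C00 T : Prop := C_dot0 T /\ C_dot0 (adj T).

Lemma inner_eq0C (x y : H) : '[x, y] = 0 -> '[y, x] = 0.
Proof. by rewrite (innerC y) => ->; rewrite rmorph0. Qed.

Definition orthoc_set A : set H := [set h | forall u, A u -> '[h, u] = 0].

Let orthoc_submod A : submod_closed [pred x | x \in orthoc_set A].
Proof.
split=> [|a x y]; first by rewrite inE => u _; exact: inner0l.
rewrite !inE => xA yA u Au.
by rewrite innerDl innerZl xA// yA// mulr0 addr0.
Qed.

Let orthoc_closed A : closed (orthoc_set A).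
Proof.
move=> x xA u Au; apply/eqP; apply: contraT; rewrite -normr_gt0 => p0.
have q0 : 0 < `|u| + 1 by rewrite ltr_wpDl.
have [y [yA]] := xA _ (nbhsx_ballx x _ (divr_gt0 p0 q0)).
rewrite -ball_normE /ball_/= ltr_pdivlMr// => xyu.
suff : `|'[x, u]| <= `|x - y| * (`|u| + 1) by move/(lt_le_trans xyu); rewrite ltxx.
rewrite -[X in '[X, _]](subrK y) innerDl (yA _ Au) addr0.
by rewrite (le_trans (inner_CS _ _))// ler_wpM2l// lerDl.
Qed.

Definition orthoc A : closed_submod H :=
  ClosedSubmod (orthoc_submod A) (@orthoc_closed A).

Definition unitary_part T : set H :=
  [set h | forall m : nat, `|iter m T h| = `|h| /\ `|iter m (adj T) h| = `|h|].

Definition cnu_space T : closed_submod H := orthoc (unitary_part T).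

Lemma contraction_adj T : contraction T -> contraction (adj T).
Proof.
move=> cT h; have [->|h0] := eqVneq (adj T h) 0; first by rewrite normr0.
rewrite -(@ler_pM2l _ `|adj T h|) ?normr_gt0//.
have := inner_CS (T (adj T h)) h.
rewrite adjE innerE normrX normr_id expr2 => /le_trans; apply.
by rewrite ler_wpM2r.
Qed.

Lemma projection_contraction P : projection P -> contraction P.
Proof.
move=> [Psa Pid] h; have [->|h0] := eqVneq (P h) 0; first by rewrite normr0.
rewrite -(@ler_pM2l _ `|P h|) ?normr_gt0//.
suff <- : `|'[P h, h]| = `|P h| * `|P h| by exact: inner_CS.
have -> : '[P h, h] = '[P h, P h].
  by rewrite {1}Pid /= adjE -Psa.
by rewrite innerE normrX normr_id expr2.
Qed.

Lemma product_contraction T : product_of_two_projections T -> contraction T.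
Proof.
move=> [P [Q [pP pQ TE]]] h; rewrite TE /=.
exact: le_trans (projection_contraction pP _) (projection_contraction pQ _).
Qed.

Lemma contraction_adjK T h : contraction T -> `|adj T h| = `|h| ->
  T (adj T h) = h.
Proof.
move=> cT hh; apply/eqP; rewrite -subr_eq0 -normr_eq0 -sqrf_eq0 -rinnerE.
have h1 : rinner (adj T h) (adj T h) = rinner h h.
  by apply: (@complexI R); rewrite !rinnerE hh.
have h2 : rinner (T (adj T h)) h = rinner h h by rewrite /rinner adjE.
have h3 : rinner (T (adj T h)) (T (adj T h)) <= rinner h h.
  by rewrite -lecR !rinnerE -hh ler_pXn2r ?nnegrE.
rewrite -[0]/(0%:C%C) (inj_eq (@complexI R)) eq_le rinner_ge0 andbT.
rewrite !(rinnerDl, rinnerDr, rinnerNl, rinnerNr) (rinnerC h) h2.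
by lra.
Qed.

Lemma cnu_space_stable T : contraction T ->
  T @` cnu_space T `<=` cnu_space T.
Proof.
move=> cT _ [h hT <-] u uT; rewrite adjE; apply: hT => m; split; last first.
  by rewrite -iterSr (uT m.+1).2 (uT 1%N).2.
case: m => [|m]//=; rewrite -/(iter m.+1 T (adj T u)) iterSr.
by rewrite contraction_adjK// ?(uT m).1 (uT 1%N).2.
Qed.

Section restriction.
Context T M (TM : T @` M `<=` M).

Let restr_fun (x : csm_type M) : csm_type M :=
  exist _ (T (\val x)) (mem_set (TM (imageP T (set_mem (valP x))))).

Let restr_linear : linear restr_fun.
Proof. by move=> a x y; apply: val_inj; rewrite /= !linearP. Qed.

HB.instance Definition _ :=
  GRing.isLinear.Build R[i] (csm_type M) (csm_type M) *:%R restr_fun restr_linear.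

Let restr_continuous : continuous restr_fun.
Proof.
apply/linear_bounded_continuous/linear_boundedP.
have /linear_bounded_continuous/linear_boundedP := @bop_continuous R H T.
by apply: filterS => r Tr x; exact: Tr.
Qed.

Definition restr : 'B(csm_type M) := Bop restr_continuous.

Lemma restrE x : \val (restr x) = T (\val x). Proof. by []. Qed.
End restriction.

Definition cnu_part T (cT : contraction T) : 'B(csm_type (cnu_space T)) :=
  restr (cnu_space_stable cT).

End operators.

(* Main.v *)
From mathcomp Require Import all_boot all_order all_algebra complex.
From mathcomp Require Import boolp classical_sets reals topology normedtype.
From mathcomp Require Import sequences lra.
Require Import Defs.

(** Write T = P Q with P and Q projections, so that T* = Q P. Two facts about
    such a product carry the proof.

    The relation T T* T = P Q Q P P Q = P Q P Q = T^2 ([product_sqr]) gives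
    T^(n+1) = T (T*T)^n, which reduces the powers of T to those of the positive
    contraction A = T*T. The powers of a positive contraction converge strongly,
    and their limit annihilates the vectors orthogonal to ker (1 - A)
    ([positive_contraction_iter_cvg0]): the moments <A^n h, h> decrease, and
    |A^m h - A^n h|^2 = <A^(2m) h, h> + <A^(2n) h, h> - 2 <A^(m+n) h, h>
    makes the orbit of h a Cauchy sequence, whose limit is fixed by A.

    A vector u fixed by T*T satisfies |P Q u| = |u|. Projections shrink every
    vector outside their range, so Q u = u and then P u = u; hence
    T u = T* u = u, and u lies in the unitary part of T
    ([product_isometric_unitary]).

    Therefore T^n h tends to 0 for every h orthogonal to the unitary part. The
    adjoint T* = Q P is again a product of two projections and has the same
    unitary part, so T*^n h tends to 0 as well. As the completely non-unitary
    space reduces T, the adjoint of the restriction is the restriction of T*,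
    and both limits hold for the completely non-unitary part. *)

Import Order.TTheory GRing.Theory Num.Theory.
Import numFieldNormedType.Exports.
Local Open Scope classical_set_scope.
Local Open Scope ring_scope.
Set Implicit Arguments.
Unset Strict Implicit.
Unset Printing Implicit Defensive.

(** * Preliminaries in a Hilbert space *)

Section hilbert.
Context {R : realType} {H : hilbertType R}.
Implicit Types (T P Q : 'B(H)) (x y h u : H).

Lemma inner_eq0 x : '[x, x] = 0 -> x = 0.
Proof. by move=> /eqP; rewrite innerE sqrf_eq0 normr_eq0 => /eqP. Qed.

Lemma rinner_le_of_norm_le x y : `|x| <= `|y| -> rinner x y <= rinner y y.
Proof.
move=> xy; have xxyy : rinner x x <= rinner y y.
  by rewrite -lecR !rinnerE ler_pXn2r ?nnegrE.
have := rinner_CS x y; have := rinner_ge0 y.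
by nra.
Qed.

Lemma adj_involutive T : (adj (adj T) : H -> H) = T.
Proof. by apply/funext => x; apply: inner_inj => v; rewrite -adjE adjE'. Qed.

Lemma cvg_seq_of_cauchy (x : nat -> H) :
  (forall e : R, 0 < e -> exists N, forall m n, (N <= m)%N -> (N <= n)%N ->
     rinner (x m - x n) (x m - x n) < e) -> cvg (x n @[n --> \oo]).
Proof.
move=> xC; apply: cauchy_cvg; apply/cauchy_ballP => e e0.
have eR : e = (complex.Re e)%:C%C by rewrite RRe_real// realE ltW.
have r0 : 0 < complex.Re e by rewrite -ltcR -eR.
have [N xN] := xC _ (exprn_gt0 2 r0).
exists (x @` [set n | (N <= n)%N], x @` [set n | (N <= n)%N]) => /=.
  by split; exists N => // n Nn; exists n.
move=> [_ _] /= [[m Nm <-] [n Nn <-]].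
by rewrite -ball_normE /ball_/= eR norm_ltcP ?ltW// xN.
Qed.

(** * Powers of a positive contraction *)

Section positive_contraction.
Variable A : 'B(H).
Hypothesis A_sym : forall x y, '[A x, y] = '[x, A y].
Hypothesis A_pos : forall x, 0 <= rinner (A x) x.
Hypothesis A_contr : contraction A.

Let moment h n := rinner (iter n A h) h.

Let iter_sym n x y : '[iter n A x, y] = '[x, iter n A y].
Proof. by elim: n x y => // n IH x y; rewrite iterSr IH -A_sym. Qed.

Let iter_moment m n h : rinner (iter m A h) (iter n A h) = moment h (m + n).
Proof. by rewrite /moment /rinner -iter_sym -iterD addnC. Qed.

(** That A^2 <= A for a positive contraction follows without square roots:
    positivity at x - A x reads <A x, x> - 2 <A^2 x, x> + <A^3 x, x> >= 0, and
    <A^3 x, x> = <A (A x), A x> is at most <A x, A x> = <A^2 x, x> by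
    Cauchy-Schwarz. *)
Let quad_decr x : rinner (A x) (A x) <= rinner (A x) x.
Proof.
have := A_pos (x - A x).
have a1 : rinner (A x) (A x) = rinner (A (A x)) x.
  by rewrite /rinner (A_sym (A x)).
have : rinner (A (A x)) (A x) <= rinner (A x) (A x).
  exact: rinner_le_of_norm_le (A_contr _).
rewrite linearB !(rinnerDl, rinnerDr, rinnerNl, rinnerNr) -a1.
by lra.
Qed.

Let quad_le x : rinner (A x) x <= rinner x x.
Proof. exact: rinner_le_of_norm_le (A_contr x). Qed.

(** Writing n as 2k or 2k+1, two consecutive moments are the values at A^k h of
    two of the quadratic forms 1 >= A >= A^2. *)
Let moment_decr h : {homo moment h : m n / (m <= n)%N >-> n <= m}.
Proof.
apply: homo_leq => [x|y x z xy yz|n]; [exact: lexx|exact: le_trans yz xy|].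
rewrite -(odd_double_half n) -addnn; case: (odd n) => /=.
  by rewrite add1n -addSn -addnS -!iter_moment /= quad_decr.
by rewrite add0n -addSn -!iter_moment /= quad_le.
Qed.

Let moment_ge0 h n : 0 <= moment h n.
Proof.
have := moment_decr h (leq_addr n n); apply: le_trans.
by rewrite -iter_moment rinner_ge0.
Qed.

Let iter_cvg h : cvg (iter n A h @[n --> \oo]).
Proof.
apply: cvg_seq_of_cauchy => e e0.
have mlb : has_inf (range (moment h)).
  split; first by exists (moment h 0); exists 0%N.
  by exists 0 => _ [n _ <-].
have [_ [N _ <-] mN] := inf_adherent (divr_gt0 e0 (ltr0Sn _ 1)) mlb.
have m_inf n : inf (range (moment h)) <= moment h n.
  by apply: ge_inf; [case: mlb|exists n].
(* The squared distance is the sum of moments 2m and 2n minus twice moment m+n: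
   the first two lie below inf + e/2, the last one above inf. *)
exists N => m n Nm Nn.
rewrite !(rinnerDl, rinnerDr, rinnerNl, rinnerNr) !iter_moment (addnC n m).
have := moment_decr h (leq_trans Nm (leq_addr m m)).
have := moment_decr h (leq_trans Nn (leq_addr n n)).
by have := m_inf (m + n)%N; lra.
Qed.

(** The limit g of A^n h is fixed by A, and <A^n h, g> = <h, A^n g> = <h, g> = 0
    for all n, so g is orthogonal to itself. *)
Lemma positive_contraction_iter_cvg0 h :
  (forall u, A u = u -> '[h, u] = 0) -> iter n A h @[n --> \oo] --> (0 : H).
Proof.
move=> h_fix; have /cvg_ex[/= g Ag] := @iter_cvg h.
have gfix : A g = g.
  apply: (@cvg_unique _ _ (A (iter n A h) @[n --> \oo])).
  - exact: norm_hausdorff.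
  - exact: (cvg_comp _ _ Ag (@bop_continuous _ _ A g)).
  - by have := Ag; rewrite -cvg_shiftS.
suff <- : g = 0 by [].
apply: inner_eq0.
have gg : orthoc_set [set g] g; last exact: gg.
apply: (closed_cvg _ (@csm_closed _ _ (orthoc [set g])) _ _ Ag).
apply: nearW => n; rewrite /orthoc/= => u ->.
by rewrite iter_sym iter_fix// h_fix.
Qed.

End positive_contraction.

Lemma gram_continuous T : continuous (adj T \o T).
Proof. by move=> x; apply: continuous_comp; apply: bop_continuous. Qed.

Definition gram T : 'B(H) :=
  @Bop R H (adj T \o T : {linear H -> H}) (@gram_continuous T).

(** If T*T u = u then |T u|^2 = <T*T u, u> = |u|^2, so it suffices to be
    orthogonal to the vectors on which T is isometric. *)
Lemma gram_iter_cvg0 T h : contraction T ->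
  (forall u, `|T u| = `|u| -> '[h, u] = 0) ->
  iter n (gram T) h @[n --> \oo] --> (0 : H).
Proof.
move=> cT h0; apply: positive_contraction_iter_cvg0 => [x y|x|x|u Tu].
- by rewrite /= adjE' adjE.
- by rewrite /rinner/= adjE'; exact: rinner_ge0.
- exact: le_trans (contraction_adj cT _) (cT x).
- apply: h0; apply/eqP; rewrite -(@eqrXn2 _ 2)//.
  by rewrite -!innerE -adjE' -[adj T (T u)]/(gram T u) Tu.
Qed.

(** * Products of two projections *)

Lemma projection_norm_eq P u : projection P -> `|P u| = `|u| -> P u = u.
Proof.
move=> pP Pu; have [Psa Pid] := pP.
have := @contraction_adjK _ _ P u (projection_contraction pP).
by rewrite -Psa => /(_ Pu); rewrite -[P (P u)]/((P \o P) u) -Pid.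
Qed.

Lemma product_adjE T P Q : projection P -> projection Q ->
  (T : H -> H) = P \o Q -> (adj T : H -> H) = Q \o P.
Proof.
move=> [Psa _] [Qsa _] TE; apply/funext => x; apply: inner_inj => v.
by rewrite -adjE TE /= adjE -Psa adjE -Qsa.
Qed.

Lemma product_of_two_projections_adj T :
  product_of_two_projections T -> product_of_two_projections (adj T).
Proof.
by move=> [P [Q [pP pQ TE]]]; exists Q, P; split=> //; apply: product_adjE TE.
Qed.

Lemma unitary_part_adj T : unitary_part (adj T) = unitary_part T.
Proof.
rewrite /unitary_part adj_involutive.
by apply/seteqP; split=> h hu m; have [] := hu m.
Qed.

(** T T* T = T^2 : with T = P Q both sides are P Q P Q, since P and Q are
    idempotent. *)
Lemma product_sqr T x : product_of_two_projections T ->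
  T (adj T (T x)) = T (T x).
Proof.
move=> [P [Q [pP pQ TE]]]; rewrite (product_adjE pP pQ TE) TE /=.
have [_ /(congr1 (fun f => f (Q x))) /= <-] := pP.
by have [_ /(congr1 (fun f => f (P (Q x)))) /= <-] := pQ.
Qed.

(** From |u| = |P Q u| <= |Q u| <= |u| the projection Q, and then P, preserves
    the norm of u, so both fix u; hence so do T = P Q and T* = Q P. *)
Lemma product_isometric_unitary T u : product_of_two_projections T ->
  `|T u| = `|u| -> unitary_part T u.
Proof.
move=> [P [Q [pP pQ TE]]]; rewrite TE /= => PQu.
have Qu : Q u = u.
  apply: (projection_norm_eq pQ); apply/eqP; rewrite eq_le.
  by rewrite projection_contraction//= -{1}PQu projection_contraction.
rewrite Qu in PQu; have Pu := projection_norm_eq pP PQu.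
have adjTE := product_adjE pP pQ TE.
by move=> m; rewrite !iter_fix// ?TE ?adjTE /= ?Qu ?Pu ?Qu.
Qed.

Lemma product_iter_cvg0 T h : product_of_two_projections T ->
  csm_set (cnu_space T) h -> iter n T h @[n --> \oo] --> (0 : H).
Proof.
move=> pT hT; rewrite -cvg_shiftS /=.
(* T^(n+1) = T (T*T)^n, by induction from T T* T = T^2. *)
have -> : (fun n => T (iter n T h)) = T \o (fun n => iter n (gram T) h).
  apply/funext => n /=; elim: n => //= n IH.
  by rewrite IH product_sqr.
have gram0 : iter n (gram T) h @[n --> \oo] --> (0 : H).
  apply: (gram_iter_cvg0 (product_contraction pT)) => u Tu.
  by apply: hT; apply: product_isometric_unitary.
have := cvg_comp _ _ gram0 (@bop_continuous _ _ T 0).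
by rewrite linear0.
Qed.

(** * Passing to the completely non-unitary part *)

Section closed_submod.
Variable M : closed_submod H.

Lemma csm_val_cvg0 (x : nat -> csm_type M) :
  \val (x n) @[n --> \oo] --> (0 : H) -> x n @[n --> \oo] --> (0 : csm_type M).
Proof.
move=> /cvgrPdist_lt x0; apply/cvgrPdist_lt => e /x0.
by apply: filterS => n; rewrite !sub0r !normrN.
Qed.

Lemma csm_val_iter (f : csm_type M -> csm_type M) (g : H -> H)
    (x : csm_type M) n :
  (forall y : csm_type M, \val (f y) = g (\val y)) ->
  \val (iter n f x) = iter n g (\val x).
Proof. by move=> fg; elim: n => [//|n IH]; rewrite !iterS fg IH. Qed.

End closed_submod.

Section cnu_part.
Variables (T : 'B(H)) (cT : contraction T).

(** T and T* have the same unitary part, so the stability of the completely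
    non-unitary space under contractions applies to T* as well. *)
Lemma cnu_space_adj_stable h :
  csm_set (cnu_space T) h -> csm_set (cnu_space T) (adj T h).
Proof.
move=> hT.
have /= := @cnu_space_stable _ _ (adj T) (contraction_adj cT) (adj T h).
by rewrite unitary_part_adj; apply; exists h.
Qed.

(** On an invariant subspace the adjoint of the restriction is the compression
    of T*; stability under T* turns this compression into a restriction. *)
Lemma adj_cnu_partE (x : csm_type (cnu_space T)) :
  \val (adj (cnu_part cT) x) = adj T (\val x).
Proof.
have xM := cnu_space_adj_stable (set_mem (valP x)).
suff -> : adj (cnu_part cT) x = exist _ (adj T (\val x)) (mem_set xM) by [].
by apply: inner_inj => v; rewrite -adjE !csm_innerE /= adjE.
Qed.

Lemma cnu_part_contraction : contraction (cnu_part cT).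
Proof. by move=> x; rewrite !csm_normE; apply: cT. Qed.

End cnu_part.
End hilbert.

Theorem theorem4p2 (R : realType) (H : hilbertType R) (sepH : separable H)
    (T : 'B(H)) (hT : product_of_two_projections T) :
  C00 (cnu_part (product_contraction hT)).
Proof.
have cS := @cnu_part_contraction _ _ _ (product_contraction hT).
split; split.
- exact: cS.
- move=> h; apply: csm_val_cvg0.
  under eq_fun do rewrite (csm_val_iter _ _ (adj_cnu_partE _)).
  apply: product_iter_cvg0 (product_of_two_projections_adj hT) _.
  by rewrite /= unitary_part_adj; exact: (set_mem (valP h)).
- exact: contraction_adj.
- move=> h; rewrite adj_involutive; apply: csm_val_cvg0.
  under eq_fun do rewrite (csm_val_iter _ _ (restrE _)).
  exact: product_iter_cvg0 hT (set_mem (valP h)).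
Qed.
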